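(* Let $n \ge 3$ be an integer, let $V_n := \{1,\dots,n\}$, and let $E_n$ be the set of all two-element subsets of $V_n$. Let $S_n \subset \mathbb{R}^{E_n}$ be the Symmetric Traveling Salesman Polytope, $P_n \subset \mathbb{R}^{E_n}$ the Graphical Traveling Salesman Polyhedron, $C_n \subset \mathbb{R}^{E_n}$ the metric cone, and $C_n^{\vartriangle}$ its polar (all as defined in the context). Then $P_n$ is the intersection of the positive orthant with the Minkowski sum of $S_n$ and $C_n^{\vartriangle}$: $$P_n = (S_n + C_n^{\vartriangle}) \cap \mathbb{R}_+^{E_n}.$$
   Context: Notation: $V_n = \{1,\dots,n\}$; $E_n$ is the set of all two-element subsets of $V_n$ (the edges of the complete graph on $V_n$); an edge $\{u,v\}$ is written $uv = vu$. $\mathbb{R}_+^{E_n} = \{x \in \mathbb{R}^{E_n} : x_e \ge 0 \text{ for all } e \in E_n\}$ is the positive (i.e. non-negative) orthant. For $a,x\in\mathbb{R}^{E_n}$, $a\cdot x = \sum_{e \in E_n} a_e x_e$. The Minkowski sum of $A,B \subset \mathbb{R}^{E_n}$ is $A+B = \{a+b : a \in A, b \in B\}$. $\operatorname{conv}$ denotes the convex hull. For a finite multi-set $F$ of elements of $E_n$, the characteristic vector $\chi^F \in \mathbb{R}^{E_n}$ is defined by letting $\chi^F_e$ be the number of occurrences of $e$ in $F$ (so for a set $F\subset E_n$, $\chi^F_e = 1$ if $e \in F$ and $0$ otherwise); $\chi^e$ abbreviates $\chi^{\{e\}}$. Symmetric Traveling Salesman Polytope: $S_n := \operatorname{conv}\{\chi^C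 : C \subset E_n \text{ is the edge set of a Hamiltonian cycle with vertex set } V_n\}$, where a Hamiltonian cycle is a cycle (circuit) visiting each vertex of $V_n$ exactly once. Graphical Traveling Salesman Polyhedron: $P_n := \operatorname{conv}\{\chi^F : F \text{ is the edge multi-set of a connected Eulerian multi-graph with vertex set } V_n\}$. Here multi-graphs may have parallel edges but no loops, so the edge multi-set is a finite multi-set of elements of $E_n$; the multi-graph has vertex set all of $V_n$, is connected (in particular every vertex is reached), and Eulerian means every vertex has even degree, counting multiplicities. Metric cone: $C_n := \{a \in \mathbb{R}^{E_n} : a_{uv} \le a_{uw} + a_{wv} \text{ for all pairwise distinct } u,v,w \in V_n\}$. Polar of the metric cone (sign convention used here): $C_n^{\vartriangle} := \{x \in \mathbb{R}^{E_n} : a \cdot x \ge 0 \text{ for all } a \in C_n\}$; equivalently, $C_n^{\vartriangle}$ is the convex cone generated by the vectors $\chi^{uw} + \chi^{wv} - \chi^{uv}$ for pairwise distinct $u,v,w \in V_n$. *)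

(* Defs.v *)
From HB Require Import structures.
From mathcomp Require Import all_boot all_order all_algebra finmap multiset.
From mathcomp Require Import boolp classical_sets reals convex.

Set Implicit Arguments.
Unset Strict Implicit.
Unset Printing Implicit Defensive.

Import Order.TTheory GRing.Theory Num.Theory.

Local Open Scope mset_scope.
Local Open Scope classical_set_scope.
Local Open Scope ring_scope.

(* The vertex set V_n is 'I_n, i.e. {0, .., n-1} rather than {1, .., n}. *)
Definition edge (n : nat) : Type := {e : {set 'I_n} | #|e| == 2%N}.

HB.instance Definition _ (n : nat) := SubFinite.on (edge n).

Lemma mkedge_subproof (n : nat) (u v : 'I_n) :
  u != v -> #|([set u; v])%SET| == 2%N.
Proof. by move=> uv; rewrite cards2 uv. Qed.

Definition mkedge (n : nat) (u v : 'I_n) (uv : u != v) : edge n :=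
  exist _ ([set u; v])%SET (mkedge_subproof uv).

(* R^o rather than R, so that vectors are found to form an R-module. *)
Notation edgevec R n := {ffun edge n -> R^o}.

Definition dot (R : realType) (n : nat) (a x : edgevec R n) : R :=
  \sum_(e : edge n) a e * x e.

(* F is a multiplicity function: a {mset edge n} coerces to it, and a set C of
   edges is passed as its 0-1 indicator. *)
Definition charvec (R : realType) (n : nat) (F : edge n -> nat) : edgevec R n :=
  [ffun e => (F e)%:R].

Definition convex_hull (R : realType) (M : lmodType R) (A : set M) : set M :=
  smallest (@convex_set R M) A.

Definition minkowski_sum (M : zmodType) (A B : set M) : set M :=
  [set x + y | x in A & y in B].

Definition orthant (R : realType) (n : nat) : set (edgevec R n) :=
  [set x : edgevec R n | forall e : edge n, 0 <= x e].

(* s lists the vertices in the order of the cycle, and next s wraps around at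
   its end. This describes a genuine cycle only when n >= 3. *)
Definition hamiltonian_cycle (n : nat) (C : {set edge n}) : Prop :=
  exists s : seq 'I_n,
    [/\ uniq s,
        forall v : 'I_n, v \in s
      & C = [set e : edge n |
               [exists v : 'I_n, val e == [set v; next s v]%SET]]%SET].

Definition adjacent (n : nat) (F : {mset edge n}) : rel 'I_n :=
  fun u v => [exists e : edge n, (e \in F) && (val e == [set u; v]%SET)].

Definition degree (n : nat) (F : {mset edge n}) (v : 'I_n) : nat :=
  (\sum_(e : edge n | v \in val e) F e)%N.

Definition connected_eulerian (n : nat) (F : {mset edge n}) : Prop :=
  (forall u v : 'I_n, connect (adjacent F) u v) /\
  (forall v : 'I_n, ~~ odd (degree F v)).

(* Symmetric Traveling Salesman Polytope S_n *)
Definition STSP (R : realType) (n : nat) : set (edgevec R n) :=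
  convex_hull [set charvec R (fun e : edge n => e \in C : nat) |
                 C in [set C : {set edge n} | hamiltonian_cycle C]].

(* Graphical Traveling Salesman Polyhedron P_n *)
Definition GTSP (R : realType) (n : nat) : set (edgevec R n) :=
  convex_hull [set charvec R F |
                 F in [set F : {mset edge n} | connected_eulerian F]].

(* Unlike usual metrics, elements are not required to be nonnegative; this
   follows from the triangle inequalities when n >= 3. *)
Definition metric_cone (R : realType) (n : nat) : set (edgevec R n) :=
  [set a : edgevec R n |
     forall (u v w : 'I_n) (uv : u != v) (uw : u != w) (wv : w != v),
       a (mkedge uv) <= a (mkedge uw) + a (mkedge wv)].

(* The sign convention is >= 0, i.e. the dual cone. *)
Definition polar (R : realType) (n : nat) (K : set (edgevec R n)) :
    set (edgevec R n) :=
  [set x : edgevec R n | forall a : edgevec R n, K a -> 0 <= dot a x].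

Arguments orthant R n : clear implicits.
Arguments STSP R n : clear implicits.
Arguments GTSP R n : clear implicits.
Arguments metric_cone R n : clear implicits.

(* Main.v *)
Require Import Defs.
From mathcomp Require Import all_boot all_order all_algebra finmap multiset.
From mathcomp Require Import boolp classical_sets reals convex.
From mathcomp Require Import interval_inference.
From mathcomp Require Import zify ring lra.

(*
  A connected Eulerian multigraph has a closed walk through all vertices using
  no edge more often than its multiplicity. Shortcutting this walk to a
  Hamiltonian cycle decreases every metric cost, which puts the generators of
  P_n, and hence P_n, into S_n + polar(C_n).

  Conversely, P_n is the sum of a polytope and the positive orthant. If x is not
  in P_n, Farkas' lemma gives a nonnegative a and a constant beta such that
  a.x < beta while a.F >= beta for every connected Eulerian F. Let b be the
  shortest path metric of a. The b-cost of a Hamiltonian cycle is the a-cost of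
  the connected Eulerian multigraph obtained by replacing each edge by a
  shortest path, so b >= beta on S_n. If moreover x = s + c >= 0 with s in S_n
  and c in the polar, then a.x >= b.x = b.s + b.c >= beta, a contradiction.
*)

Set Implicit Arguments.
Unset Strict Implicit.
Unset Printing Implicit Defensive.

Import Order.TTheory GRing.Theory Num.Theory.

(** * Farkas' lemma and convexity *)

Section Farkas.
Local Open Scope ring_scope.
Local Open Scope classical_set_scope.

Definition inner (R : realType) (I : finType) (a x : {ffun I -> R^o}) : R :=
  \sum_i a i * x i.

Definition convex_cone (R : realType) (V : lmodType R) (K : set V) :=
  K 0 /\ forall s t x y, 0 <= s -> 0 <= t -> K x -> K y -> K (s *: x + t *: y).

Variables (R : realType) (I : finType).
Implicit Types (a b v w x y : {ffun I -> R^o}) (s : seq {ffun I -> R^o}).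

Lemma innerDl a b x : inner (a + b) x = inner a x + inner b x.
Proof. by rewrite -big_split; apply: eq_bigr => e _; rewrite !ffunE mulrDl. Qed.

Lemma innerDr a x y : inner a (x + y) = inner a x + inner a y.
Proof. by rewrite -big_split; apply: eq_bigr => e _; rewrite !ffunE mulrDr. Qed.

Lemma innerZl (t : R) a x : inner (t *: a) x = t * inner a x.
Proof. by rewrite mulr_sumr; apply: eq_bigr => e _; rewrite !ffunE mulrA. Qed.

Lemma innerZr a (t : R) x : inner a (t *: x) = t * inner a x.
Proof. by rewrite mulr_sumr; apply: eq_bigr => e _; rewrite !ffunE mulrCA. Qed.

Lemma inner_gt0 x : x != 0 -> 0 < inner x x.
Proof.
move=> x0; rewrite lt_def sumr_ge0 ?andbT => [|i _]; last exact: sqr_ge0.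
apply: contra x0; rewrite psumr_eq0 => [/allP h|i _]; last exact: sqr_ge0.
apply/eqP/ffunP => i; apply/eqP; rewrite ffunE.
by have := h i (mem_index_enum _); rewrite /= mulf_eq0 orbb.
Qed.

(* Induction on the number of generators: if the separating functional [a] of
   the generators [s] fails on the new one [v], project everything along [v]
   onto the kernel of [a]. *)
Lemma farkas s b :
  (forall K, convex_cone K -> (forall v, v \in s -> K v) -> K b) \/
  exists2 a, forall v, v \in s -> 0 <= inner a v & inner a b < 0.
Proof.
move: {2}(size s) (erefl (size s)) => k; elim: k s b => [|k IH] [|v s] b //.
  have [-> _|b0 _] := eqVneq b 0; first by left=> K [].
  right; exists (- b); rewrite // -scaleN1r innerZl mulN1r oppr_lt0.
  exact: inner_gt0.
case=> size_s; have [in_s|[a as_ab ab]] := IH s b size_s.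
  by left=> K cK Ks; apply: in_s => // w ws; apply: Ks; rewrite inE ws orbT.
have [av|av] := leP 0 (inner a v).
  by right; exists a => // w; rewrite inE => /predU1P[->|/as_ab].
pose pr w := w - (inner a w / inner a v) *: v.
have [in_s|[c cs cb]] := IH _ (pr b) (etrans (size_map pr s) size_s).
  (* As [inner a v < 0], both [b - pr b] and [pr w - w] for [w] in [s] are nonnegative multiples of
     [v]. *)
  left=> K cK Ks; have [_ KD] := cK.
  have -> : b = 1 *: pr b + (inner a b / inner a v) *: v.
    by rewrite scale1r subrK.
  apply: (KD) => //; last by apply: Ks; rewrite mem_head.
    by rewrite nmulr_lge0 ?invr_lt0 // ltW.
  apply: in_s => // _ /mapP[w ws ->].
  rewrite /pr -scaleNr -[w in w + _]scale1r; apply: KD => //.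
  - by rewrite oppr_ge0 mulr_ge0_le0 ?as_ab // invr_le0 ltW.
  - by apply: Ks; rewrite inE ws orbT.
  - by apply: Ks; rewrite mem_head.
(* This is [c] composed with [pr]; it vanishes on [v] because [pr v = 0]. *)
right; exists (c - (inner c v / inner a v) *: a).
all: have cE w : inner (c - (inner c v / inner a v) *: a) w = inner c (pr w) by
  rewrite innerDl -scaleNr innerZl innerDr -scaleNr innerZr;
  field; rewrite lt_eqF.
  move=> w; rewrite inE cE => /predU1P[->|ws]; last by apply: cs; apply: map_f.
  rewrite /pr divff ?lt_eqF // scale1r subrr /inner big1 // => i _.
  by rewrite ffunE mulr0.
by rewrite cE.
Qed.

End Farkas.

Section Convexity.
Local Open Scope ring_scope.
Local Open Scope classical_set_scope.
Variables (R : realType) (V : lmodType R).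
Implicit Types (A : set V) (x y : V).

Lemma convex_setP A : @convex_set R V A <->
  forall (s t : R) x y, 0 <= s -> 0 <= t -> s + t = 1 -> A x -> A y ->
    A (s *: x + t *: y).
Proof.
split=> [cA s t x y s0 t0 st Ax Ay|cA x y l /set_mem Ax /set_mem Ay].
  have s1 : s <= 1 by rewrite -st lerDl.
  have := cA x y (Itv01 s0 s1) (mem_set Ax) (mem_set Ay) => /set_mem.
  by rewrite /conv /= /unstable.onem -st [s + t]addrC addrK.
rewrite in_setE; apply: cA; rewrite ?unstable.add_onemK //.
by rewrite unstable.onem_ge0.
Qed.

Lemma convex_hull_convex A (s t : R) x y : 0 <= s -> 0 <= t -> s + t = 1 ->
  convex_hull A x -> convex_hull A y -> convex_hull A (s *: x + t *: y).
Proof.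
move=> s0 t0 st Ax Ay B [cB AB].
by move/convex_setP: (cB); apply=> //; [apply: Ax | apply: Ay].
Qed.

Lemma sub_convex_hull A : A `<=` convex_hull A.
Proof. exact: sub_gen_smallest. Qed.

Lemma convex_hull_sub A B :
  (forall (s t : R) x y, 0 <= s -> 0 <= t -> s + t = 1 -> B x -> B y ->
    B (s *: x + t *: y)) -> A `<=` B -> convex_hull A `<=` B.
Proof. by move=> /convex_setP cB; apply: smallest_sub. Qed.

End Convexity.

(** * Closed walks in connected Eulerian multigraphs *)

Section Multigraphs.
Variable n : nat.
Implicit Types (e : edge n) (f g : edge n -> nat) (u v w x y z : 'I_n).
Implicit Types (p q s : seq 'I_n).

(* [adj] and [deg] are [adjacent] and [degree] for arbitrary multiplicity
   functions instead of multisets. *)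
Definition adj f : rel 'I_n :=
  fun u v => [exists e : edge n, (0 < f e) && (val e == [set u; v]%SET)].

Definition deg f v := \sum_(e : edge n | v \in val e) f e.

(* The zero function when [u = v], so that stationary steps of a walk count
   for nothing. *)
Definition step u v e : nat := val e == [set u; v]%SET.

Fixpoint walk_count x p e : nat :=
  if p is y :: p' then step x y e + walk_count y p' e else 0.

Lemma edge_at e v : v \in val e -> exists2 u, v != u & val e = [set v; u]%SET.
Proof.
have /cards2P[x [y [xy ->]]] : #|val e| == 2 := valP e.
rewrite !inE => /orP[/eqP->|/eqP->]; first by exists y.
by exists x; rewrite 1?eq_sym // finset.setUC.
Qed.

Lemma edge_ends e : exists u v, u != v /\ val e = [set u; v]%SET.
Proof. by have /cards2P[x [y [xy ->]]] : #|val e| == 2 := valP e; exists x, y. Qed.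

Lemma stepxx x e : step x x e = 0.
Proof.
rewrite /step; case: eqP => // ex; have : #|val e| == 2 := valP e.
by rewrite ex finset.setUid cards1.
Qed.

Lemma step_mkedge u v (uv : u != v) e : step u v e = (e == mkedge uv).
Proof. by rewrite /step -val_eqE. Qed.

Lemma eq_deg f g v : f =1 g -> deg f v = deg g v.
Proof. by move=> fg; apply: eq_bigr => e _; rewrite fg. Qed.

Lemma degD f g v : deg (fun e => f e + g e) v = deg f v + deg g v.
Proof. exact: big_split. Qed.

Lemma odd_deg_step u v w : odd (deg (step u v) w) = (w == u) (+) (w == v).
Proof.
rewrite /deg; have [<-|uv] := eqVneq u v.
  by rewrite big1 ?addbb // => e _; exact: stepxx.
rewrite big_mkcond (bigD1 (mkedge uv)) //= big1 => [|e euv]; last first.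
  by rewrite step_mkedge (negbTE euv); case: ifP.
rewrite step_mkedge eqxx addn0 !inE.
have [->|wu] := eqVneq w u; first by rewrite (negbTE uv).
by case: (w == v).
Qed.

Lemma walk_count_cat x p q e :
  walk_count x (p ++ q) e = walk_count x p e + walk_count (last x p) q e.
Proof. by elim: p x => //= y p IH x; rewrite IH addnA. Qed.

(** Every passage through a vertex uses one step in and one out, so parities telescope. In
    particular a closed walk has only even degrees. *)
Lemma odd_deg_walk x p v :
  odd (deg (walk_count x p) v) = (v == x) (+) (v == last x p).
Proof.
elim: p x => [|y p IH] x /=; first by rewrite addbb /deg big1.
by rewrite degD oddD odd_deg_step IH -addbA addKb.
Qed.

Lemma walk_count_gt0 x p e :
  0 < walk_count x p e -> val e \subset x :: p.
Proof.
elim: p x => //= y p IH x; rewrite addn_gt0 => /orP[|/IH/fintype.subsetP yp].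
  rewrite lt0b => /eqP->; apply/fintype.subsetP => z.
  by rewrite !inE orbA => ->.
by apply/fintype.subsetP => z /yp zyp; rewrite inE zyp orbT.
Qed.

Lemma odd_deg_edge f z :
  odd (deg f z) -> exists2 e : edge n, z \in val e & 0 < f e.
Proof.
have [//|noe] := boolp.pselect (exists2 e : edge n, z \in val e & 0 < f e).
rewrite /deg big1 // => e ze; apply/eqP; rewrite -leqn0 leqNgt.
by apply/negP => fe; apply: noe; exists e.
Qed.

(* A vertex of odd degree has an incident edge; removing it moves the oddness
   to its other end. *)
Lemma trail f x z : x != z ->
  (forall v, odd (deg f v) = (v == x) (+) (v == z)) ->
  exists2 p, last z p = x & forall e, walk_count z p e <= f e.
Proof.
move: {2}(\sum_e f e) (leqnn (\sum_e f e)) => k.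
elim: k f x z => [|k IH] f x z hk xz odd_f.
all: have : odd (deg f z) by rewrite odd_f eq_sym (negbTE xz) eqxx.
all: case/odd_deg_edge => e ze fe.
  by move: hk; rewrite (bigD1 e) //=; lia.
have [y zy ey] := edge_at ze.
have e_zy : mkedge zy = e by apply: val_inj.
have f1 e' : step z y e' <= f e'.
  by rewrite (step_mkedge zy) e_zy; case: eqP => // ->.
pose g e' := f e' - step z y e'.
have fg e' : f e' = step z y e' + g e' by rewrite subnKC.
have odd_g v : odd (deg g v) = (v == x) (+) (v == y).
  have := odd_f v; rewrite (eq_deg v fg) degD oddD odd_deg_step.
  by case: (v == x); case: (v == y); case: (v == z); case: (odd _).
have [->|xy] := eqVneq x y.
  by exists [:: y] => // e'; rewrite /= addn0 fg leq_addr.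
have [|||p lp hp] := IH g x y.
- move: hk; rewrite (eq_bigr _ (fun e' _ => fg e')) big_split /= (bigD1 e) //=.
  by rewrite (step_mkedge zy) e_zy eqxx; lia.
- exact: xy.
- exact: odd_g.
by exists (y :: p) => //= e'; rewrite fg leq_add2l.
Qed.

Lemma connect_adjC f : connect_sym (adj f).
Proof.
apply: sym_connect_sym => u v; apply: eq_existsb => e.
by rewrite finset.setUC.
Qed.

(** Otherwise [A] would be closed under adjacency and contain [b] along with [a]. *)
Lemma crossing_edge f (A : {set 'I_n}) (a b : 'I_n) :
  connect (adj f) a b -> a \in A -> b \notin A ->
  exists x y, [/\ x \in A, y \notin A & adj f x y].
Proof.
move=> ab aA bA.
have [//|nocross] :=
  boolp.pselect (exists x y, [/\ x \in A, y \notin A & adj f x y]).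
have cl : closed (adj f) (mem A).
  apply: (intro_closed (connect_adjC f)) => x y xy xA; rewrite -[y \in _]negbK.
  by apply/negP => yA; apply: nocross; exists x, y.
by move: bA; rewrite -(closed_connect cl ab) aA.
Qed.

Lemma closed_walk_rot x p z : last x p = x -> z \in x :: p ->
  exists p', [/\ last z p' = z, walk_count z p' =1 walk_count x p
    & z :: p' =i x :: p].
Proof.
move=> lp zp; case/splitPl: zp lp => p1 p2 lp1.
rewrite last_cat lp1 => lp2; exists (p2 ++ p1); split.
- by rewrite last_cat lp2.
- by move=> e; rewrite !walk_count_cat lp1 lp2 addnC.
have zx : z \in x :: p1 by rewrite -lp1 mem_last.
have xz : x \in z :: p2 by rewrite -lp2 mem_last.
move=> v; rewrite !inE !mem_cat [(v \in p2) || _]orbC.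
apply/predU1P/predU1P => -[->|vp]; try by right.
  by move: zx; rewrite inE => /predU1P[|->]; [left|right].
by move: xz; rewrite inE => /predU1P[|->]; [left|right; rewrite orbT].
Qed.

(* From a vertex [y] not yet visited but joined by an unused edge to a visited
   vertex [x], a trail in the unused edges leads back to [x]. *)
Lemma euler_walk f (x0 : 'I_n) :
  (forall u v, connect (adj f) u v) -> (forall v, ~~ odd (deg f v)) ->
  exists x p, [/\ last x p = x, forall v, v \in x :: p
    & forall e, walk_count x p e <= f e].
Proof.
move=> conn even_f.
(* Induction on the number of unvisited vertices, starting from the empty walk at [x0]. *)
suff ext k x p : #|[predC x :: p]| <= k -> last x p = x ->
    (forall e, walk_count x p e <= f e) ->
    exists x p, [/\ last x p = x, forall v, v \in x :: p
      & forall e, walk_count x p e <= f e].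
  exact: (ext #|[predC [:: x0]]| x0 [::]).
elim: k x p => [|k IH] x p hk lp hp.
  exists x, p; split=> // v; apply: contraT => vp.
  by move: hk; rewrite leqn0 => /eqP/card0_eq/(_ v); rewrite inE /= vp.
have [/forallP all_p|] := boolP [forall v, v \in x :: p]; first by exists x, p.
move=> /forallPn[b bp].
have [||z [y [zp yp /existsP[e /andP[fe /eqP ezy]]]]] :=
  @crossing_edge f [set v in x :: p]%SET x b (conn x b).
- by rewrite !inE eqxx.
- by rewrite inE.
move: zp yp; rewrite 2!finset.in_set => zp yp.
have zy : z != y by apply: contraNneq yp => <-.
have e_zy : mkedge zy = e by apply: val_inj.
have unused e' : walk_count x p e' + step z y e' <= f e'.
  rewrite (step_mkedge zy) e_zy; case: eqP => [->|_]; last by rewrite addn0.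
  rewrite (_ : walk_count x p e = 0) //; apply/eqP; rewrite -leqn0 leqNgt.
  apply: contra yp => /walk_count_gt0/fintype.subsetP; apply.
  by rewrite ezy !inE eqxx orbT.
pose g e' := f e' - (walk_count x p e' + step z y e').
have fg e' : f e' = (walk_count x p e' + step z y e') + g e' by rewrite subnKC.
have odd_g v : odd (deg g v) = (v == z) (+) (v == y).
  have := even_f v; rewrite (eq_deg v fg) !degD !oddD odd_deg_step odd_deg_walk.
  by rewrite lp addbb; case: (v == y); case: (v == z); case: (odd _).
have [q lq hq] := trail zy odd_g.
have [p' [lp' hp' eqp']] := closed_walk_rot lp zp.
(* The longer walk goes from [z] to [y], returns to [z] along the trail [q], then follows the old
   walk rotated to start at [z]. *)
apply: (IH z (y :: q ++ p')) => [||e'].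
- rewrite -ltnS (leq_trans _ hk) //; apply: proper_card; apply/properP; split.
    apply/fintype.subsetP => v vN.
    rewrite inE /= -eqp'; move: vN; rewrite inE /=; apply: contra.
    by rewrite !inE mem_cat => /orP[->|->]; rewrite ?orbT.
  by exists y; rewrite inE /= ?yp // !inE eqxx orbT.
- by rewrite /= last_cat lq.
- by rewrite /= walk_count_cat lq hp' fg; have := hq e'; lia.
Qed.


Lemma connect_adjS f g : (forall e, 0 < f e -> 0 < g e) ->
  subrel (connect (adj f)) (connect (adj g)).
Proof.
move=> fg; apply: connect_sub => u v /existsP[e /andP[/fg ge euv]].
by apply/connect1/existsP; exists e; rewrite ge.
Qed.

Lemma connect_walk x p v :
  v \in x :: p -> connect (adj (walk_count x p)) x v.
Proof.
elim: p x => [|y p IH] x; first by rewrite inE => /eqP->.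
rewrite inE => /predU1P[-> //|/IH vp].
apply: (@connect_trans _ _ y); last first.
  by apply: connect_adjS vp => e /= h; rewrite addn_gt0 h orbT.
have [->//|xy] := eqVneq x y; apply/connect1/existsP; exists (mkedge xy).
by rewrite /= (step_mkedge xy) !eqxx.
Qed.

Lemma walk_countE x p e :
  walk_count x p e = \sum_(i < size p) step (nth x (x :: p) i) (nth x p i) e.
Proof.
elim: p x => [|y p IH] x; first by rewrite big_ord0.
rewrite big_ord_recl /= IH; congr (_ + _); apply: eq_bigr => i _.
by congr step; apply: set_nth_default => //=; rewrite ltnS ltnW.
Qed.

(** The walk around the cycle makes one step from each vertex to its successor. With at least three
    vertices no edge is used twice, so the count is a 0-1 indicator. *)
Lemma walk_count_next x q e : 2 < n -> uniq (x :: q) ->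
  (forall v, v \in x :: q) ->
  walk_count x (rcons q x) e =
    [exists v, val e == [set v; next (x :: q) v]%SET].
Proof.
move=> n3 Us all_s; set s := x :: q.
have size_s : size s = n.
  by rewrite -(card_uniqP Us) (eq_card (B := 'I_n)) ?card_ord.
transitivity (\sum_v step v (next s v) e).
  rewrite walk_countE size_rcons -[_.+1]/(size s).
  rewrite [RHS](perm_big s); last first.
    apply: uniq_perm; rewrite ?index_enum_uniq // => v.
    by rewrite mem_index_enum all_s.
  rewrite [RHS](big_nth x) big_mkord; apply: eq_bigr => i _.
  rewrite next_nth mem_nth // index_uniq // -rcons_cons !nth_rcons.
  rewrite ltn_ord; congr step; case: ltnP => // iq.
  (* At the last position the default value [x] of [nth] is the vertex to which [next] wraps
     around. *)
  by rewrite nth_default //; case: eqP.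
have [/existsP[v0 ev0]|/existsPn no_v] :=
  boolP [exists v : 'I_n, val e == [set v; next s v]%SET]; last first.
  by rewrite big1 // => v _; rewrite /step (negbTE (no_v v)).
rewrite (bigD1 v0) //= [step _ _ _]/step ev0 big1 // => v vv0.
apply/eqP; rewrite eqb0; apply/negP; rewrite (eqP ev0) => /eqP ev.
have v0_next : v0 = next s v.
  have : v0 \in [set v; next s v]%SET by rewrite -ev !inE eqxx.
  by rewrite !inE eq_sym (negbTE vv0) => /eqP.
have v_next : v = next s v0.
  have : v \in [set v0; next s v0]%SET by rewrite ev !inE eqxx.
  by rewrite !inE (negbTE vv0) => /eqP.
(* Here [v] and [v0] succeed each other. Rotated to start at [v0], the cycle would close up after
   two vertices, contradicting [2 < n]. *)
have [i t rot_s] := rot_to (all_s v0).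
have := rot_uniq i s; rewrite Us rot_s.
move: v0_next v_next size_s; rewrite -!(next_rot i Us) -(size_rot i) rot_s.
case: t {rot_s} => [|y [|z t]] /=; rewrite ?eqxx; try lia.
move=> v0z vy _; move: v0z; rewrite vy eqxx !inE => v0z.
by move: v0z; rewrite -vy (negbTE vv0) => ->; rewrite eqxx orbT.
Qed.

End Multigraphs.

(** * Edge costs, shortcutting and Hamiltonian cycles *)

Section Costs.
Variables (R : realType) (n : nat).
Local Open Scope mset_scope.
Local Open Scope ring_scope.
Implicit Types (e : edge n) (f g : edge n -> nat) (u v w x y z : 'I_n).
Implicit Types (p q s : seq 'I_n) (a b : edgevec R n).

Definition connected_even f :=
  (forall u v, connect (adj f) u v) /\ (forall v, ~~ odd (deg f v)).

Definition mset_of f : {mset edge n} :=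
  [fsfun e in seq_fset tt (enum {: edge n}) => f e].

Lemma mset_ofE f : mset_of f =1 f.
Proof. by move=> e; rewrite fsfunE seq_fsetE mem_enum. Qed.

Lemma connected_eulerianE (F : {mset edge n}) :
  connected_eulerian F <-> connected_even F.
Proof.
have adjE : adjacent F =2 adj F.
  by move=> u v; apply: eq_existsb => e; rewrite in_mset.
by split=> -[conn ev]; split=> // u v; have := conn u v;
  rewrite (eq_connect adjE).
Qed.

Lemma eq_charvec f g : f =1 g -> charvec R f = charvec R g.
Proof. by move=> fg; apply/ffunP => e; rewrite !ffunE fg. Qed.

Lemma connected_even_generator f : connected_even f ->
  [set charvec R F | F in [set F : {mset edge n} | connected_eulerian F]]%classic
    (charvec R f).
Proof.
move=> cf; exists (mset_of f); last exact/eq_charvec/mset_ofE.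
apply/connected_eulerianE; case: cf => conn ev; split=> [u v|v].
  by apply: connect_adjS (conn u v) => e; rewrite mset_ofE.
by rewrite (eq_deg v (mset_ofE f)).
Qed.

Lemma dotDr a (x y : edgevec R n) : dot a (x + y) = dot a x + dot a y.
Proof. exact: innerDr. Qed.

Lemma dotZr a (t : R) (x : edgevec R n) : dot a (t *: x) = t * dot a x.
Proof. exact: innerZr. Qed.

Lemma dotNr a (x : edgevec R n) : dot a (- x) = - dot a x.
Proof. by rewrite -scaleN1r dotZr mulN1r. Qed.

Lemma ler_dotl a b (x : edgevec R n) :
  (forall e, 0 <= x e) -> (forall e, a e <= b e) -> dot a x <= dot b x.
Proof. by move=> x0 ab; apply: ler_sum => e _; apply: ler_wpM2r. Qed.

Lemma ler_dotr a (x y : edgevec R n) :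
  (forall e, 0 <= a e) -> (forall e, x e <= y e) -> dot a x <= dot a y.
Proof. by move=> a0 xy; apply: ler_sum => e _; apply: ler_wpM2l. Qed.

Definition cost a f : R := dot a (charvec R f).

Lemma eq_cost a f g : f =1 g -> cost a f = cost a g.
Proof. by move=> fg; rewrite /cost (eq_charvec fg). Qed.

Lemma costD a f g : cost a (fun e => (f e + g e)%N) = cost a f + cost a g.
Proof.
by rewrite -dotDr; congr dot; apply/ffunP => e; rewrite !ffunE natrD.
Qed.

Lemma ler_cost a f g :
  (forall e, 0 <= a e) -> (forall e, (f e <= g e)%N) -> cost a f <= cost a g.
Proof. by move=> a0 fg; apply: ler_dotr => // e; rewrite !ffunE ler_nat. Qed.

Lemma cost_mkedge a u v (uv : u != v) : cost a (step u v) = a (mkedge uv).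
Proof.
rewrite /cost /dot (bigD1 (mkedge uv)) //= big1 => [|e].
  by rewrite ffunE (step_mkedge uv) eqxx mulr1 addr0.
by rewrite ffunE (step_mkedge uv) => /negbTE->; rewrite mulr0.
Qed.

Lemma cost_stepxx a x : cost a (step x x) = 0.
Proof. by rewrite /cost /dot big1 // => e _; rewrite ffunE stepxx mulr0. Qed.

Lemma third_vertex u v : (2 < n)%N -> exists w, (w != u) && (w != v).
Proof.
move=> n3; have : (0 < #|~: [set u; v]%SET|)%N.
  have := cardsC [set u; v]%SET; rewrite card_ord cards2.
  by case: (u != v); lia.
by case/card_gt0P => w; rewrite !inE negb_or; exists w.
Qed.

(** For a third vertex [w], adding the triangle inequalities for [wu] and [wv] leaves
    [0 <= 2 * a e], where [e = uv]. *)
Lemma metric_ge0 a : (2 < n)%N -> metric_cone R n a -> forall e, 0 <= a e.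
Proof.
move=> n3 ma e; have [u [v [uv ev]]] := edge_ends e.
have [w /andP[wu wv]] := third_vertex u v n3.
have vw : v != w by rewrite eq_sym.
have vu : v != u by rewrite eq_sym.
have uw : u != w by rewrite eq_sym.
have -> : e = mkedge uv by apply: val_inj.
have := ma w u v wu wv vu; have := ma w v u wv wu uv.
have -> : mkedge vu = mkedge uv by apply: val_inj; apply: finset.setUC.
lra.
Qed.

Lemma metric_step a u v w : (2 < n)%N -> metric_cone R n a ->
  cost a (step u v) <= cost a (step u w) + cost a (step w v).
Proof.
move=> n3 ma; have a0 := metric_ge0 n3 ma.
have cost_ge0 x y : 0 <= cost a (step x y).
  by apply: sumr_ge0 => e _; rewrite ffunE mulr_ge0.
have [->|uv] := eqVneq u v; first by rewrite cost_stepxx addr_ge0.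
have [->|uw] := eqVneq u w; first by rewrite cost_stepxx add0r.
have [->|wv] := eqVneq w v; first by rewrite cost_stepxx addr0.
by rewrite !cost_mkedge.
Qed.

Lemma cost_walk_cons a x y p :
  cost a (walk_count x (y :: p)) = cost a (step x y) + cost a (walk_count y p).
Proof. exact: costD. Qed.

(** Skipping an intermediate vertex replaces two steps by one, which costs no more by the triangle
    inequality. *)
Lemma shortcut a x z p q : (2 < n)%N -> metric_cone R n a -> subseq q p ->
  cost a (walk_count x (rcons q z)) <= cost a (walk_count x (rcons p z)).
Proof.
move=> n3 ma; elim: p x q => [|y p IH] x q; first by rewrite subseq0 => /eqP->.
case: q => [_|y' q].
  rewrite rcons_cons !cost_walk_cons.
  apply: le_trans _ (lerD (lexx _) (IH y [::] (sub0seq _))).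
  by rewrite !cost_walk_cons addrA lerD2r metric_step.
rewrite [subseq _ _]/= !rcons_cons.
have [-> /(IH y)|_ /(IH y)] := eqVneq y' y; rewrite !cost_walk_cons.
  by rewrite lerD2l.
move=> h; apply: le_trans _ (lerD (lexx _) h).
by rewrite -/(rcons q z) addrA lerD2r metric_step.
Qed.

(** The cycle depends on [f] alone and serves all metrics [a] at once; this puts the difference of
    the characteristic vectors into the polar. *)
Lemma hamiltonian_shortcut f : (2 < n)%N -> connected_even f ->
  exists2 C : {set edge n}, hamiltonian_cycle C & forall a, metric_cone R n a ->
    cost a (fun e => e \in C : nat) <= cost a f.
Proof.
move=> n3 [conn ev]; have n0 : (0 < n)%N by lia.
have [x [p [lp all_p hp]]] := euler_walk (Ordinal n0) conn ev.
have [y /andP[yx _]] := third_vertex x x n3.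
have [p' def_p] : exists p', p = rcons p' x.
  case/lastP: p lp all_p {hp} => [_ /(_ y)|p' x' <- _].
    by rewrite inE (negbTE yx).
  by rewrite last_rcons; exists p'.
(* Only one visit to each vertex other than [x] is kept. *)
pose q := [seq v <- undup p' | v != x].
have sub_q : subseq q p' := subseq_trans (filter_subseq _ _) (undup_subseq _).
have uniq_q : uniq (x :: q).
  by rewrite /= mem_filter eqxx filter_uniq ?undup_uniq.
have all_q v : v \in x :: q.
  have := all_p v; rewrite def_p !inE mem_rcons inE mem_filter mem_undup.
  by case: eqP.
pose C := [set e : edge n |
  [exists v : 'I_n, val e == [set v; next (x :: q) v]%SET]]%SET.
exists C; first by exists (x :: q).
move=> a ma; rewrite (@eq_cost _ _ (walk_count x (rcons q x))) => [|e].
  apply: le_trans (shortcut x x n3 ma sub_q) _; rewrite -def_p.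
  exact: ler_cost (metric_ge0 n3 ma) hp.
by rewrite walk_count_next // inE.
Qed.

(** Evenness and connectedness come from reading the cycle as a closed walk through all vertices. *)
Lemma hamiltonian_connected_even (C : {set edge n}) : (2 < n)%N ->
  hamiltonian_cycle C -> connected_even (fun e => e \in C : nat).
Proof.
move=> n3 [[|x q] [Us all_s defC]].
  by have n0 : (0 < n)%N by [lia]; have := all_s (Ordinal n0).
have CE e : (e \in C : nat) = walk_count x (rcons q x) e.
  by rewrite walk_count_next // defC inE.
split=> [u v|v]; last first.
  by rewrite (eq_deg v CE) odd_deg_walk last_rcons addbb.
have cx w : connect (adj (fun e => e \in C : nat)) x w.
  apply: (@connect_adjS _ (walk_count x (rcons q x))) => [e|].
    by rewrite CE.
  by apply: connect_walk; rewrite inE mem_rcons orbA orbb -in_cons.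
by apply: (@connect_trans _ _ x); rewrite // connect_adjC.
Qed.

End Costs.

(** * Shortest path metrics *)

Section Joins.
Variable n : nat.
Implicit Types (e : edge n) (f g : edge n -> nat) (u v w x y : 'I_n).

(** For distinct [u] and [v], this is a T-join for T = {u, v} whose support connects [u] and [v]. *)
Definition join f u v :=
  connect (adj f) u v /\ forall w, odd (deg f w) = (w == u) (+) (w == v).

(* [edge_join f e]: [f] could replace the edge [e] in a connected Eulerian
   multigraph. Such [f] play the role of paths between the ends of [e], and
   form a class stable under sums and under reduction of multiplicities. *)
Definition edge_join f e := forall u v, val e = [set u; v]%SET -> join f u v.

Lemma join_sym f u v : join f u v -> join f v u.
Proof. by case=> c o; split=> [|w]; rewrite 1?connect_adjC // addbC. Qed.

Lemma join_trans f g u v w :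
  join f u w -> join g w v -> join (fun e => f e + g e) u v.
Proof.
move=> [cf of_] [cg og]; split=> [|x]; last first.
  by rewrite degD oddD of_ og -addbA addKb.
apply: (@connect_trans _ _ w).
  by apply: connect_adjS cf => e h; rewrite addn_gt0 h.
by apply: connect_adjS cg => e h; rewrite addn_gt0 h orbT.
Qed.

Lemma join_edge f e u v :
  u != v -> val e = [set u; v]%SET -> join f u v -> edge_join f e.
Proof.
move=> uv ev j x y; rewrite ev => eq_xy.
have : u \in [set x; y]%SET by rewrite -eq_xy !inE eqxx.
have : v \in [set x; y]%SET by rewrite -eq_xy !inE eqxx orbT.
rewrite !inE => /orP[]/eqP ? /orP[]/eqP ?; subst => //.
- by rewrite eqxx in uv.
- exact: join_sym.
- by rewrite eqxx in uv.
Qed.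

Lemma edge_join_mkedge u v (uv : u != v) : edge_join (step u v) (mkedge uv).
Proof.
apply: (@join_edge _ _ u v) => //; split; last exact: odd_deg_step.
by apply/connect1/existsP; exists (mkedge uv); rewrite (step_mkedge uv) !eqxx.
Qed.

Lemma odd_deg_edge_join f e w : edge_join f e -> odd (deg f w) = (w \in val e).
Proof.
have [u [v [uv ev]]] := edge_ends e; move=> /(_ u v ev)[_ ->].
rewrite ev !inE; case: eqP => [->|] //=.
Qed.

Lemma odd_sum (I : finType) (F G : I -> nat) :
  (forall i, odd (F i) = odd (G i)) -> odd (\sum_i F i) = odd (\sum_i G i).
Proof.
move=> FG; rewrite !(big_morph odd oddD (erefl _)).
by apply: eq_bigr => i _; rewrite FG.
Qed.

(** Each copy of an edge [i] is replaced by [G i], which connects the ends of [i] and changes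
    degrees with the same parity as [i]. *)
Lemma connected_even_subst f (G : edge n -> edge n -> nat) :
  (forall e, edge_join (G e) e) -> connected_even f ->
  connected_even (fun e => \sum_i f i * G i e).
Proof.
move=> jG [conn ev]; split=> [u v|v].
  apply: connect_sub (conn u v) => x y /existsP[i /andP[fi /eqP ei]].
  apply: connect_adjS (proj1 (jG i x y ei)) => e Ge.
  by rewrite (bigD1 i) //= addn_gt0 muln_gt0 fi Ge.
suff -> : odd (deg (fun e => \sum_i f i * G i e) v) = odd (deg f v) by [].
rewrite /deg exchange_big /= [in RHS]big_mkcond /=; apply: odd_sum => i.
rewrite -big_distrr oddM (odd_deg_edge_join v (jG i)).
by case: (v \in _); rewrite ?andbT ?andbF.
Qed.

(* Deleting pairs of parallel edges bounds the multiplicities by 2. *)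
Lemma reduce_multiplicities f : exists r : {ffun edge n -> 'I_3},
  forall e, [/\ r e <= f e, (0 < r e) = (0 < f e) & odd (r e) = odd (f e)].
Proof.
pose r e := if f e == 0 then 0 else 2 - odd (f e).
have r3 e : r e < 3 by rewrite /r; case: eqP => // _; case: (odd _).
exists [ffun e => Ordinal (r3 e)] => e; rewrite !ffunE /= /r.
by case: (f e) => [|[|k]] //=; split; case: (odd k).
Qed.

Section SameParity.
Variables f g : edge n -> nat.
Hypotheses (fg0 : forall e, (0 < g e) = (0 < f e))
  (fg2 : forall e, odd (g e) = odd (f e)).

Lemma odd_deg_parity v : odd (deg g v) = odd (deg f v).
Proof.
rewrite /deg [in LHS]big_mkcond [in RHS]big_mkcond.
by apply: odd_sum => e; case: ifP.
Qed.

Lemma connect_support u v : connect (adj f) u v -> connect (adj g) u v.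
Proof. by apply: connect_adjS => e; rewrite fg0. Qed.

Lemma connected_even_parity : connected_even f -> connected_even g.
Proof.
case=> conn ev; split=> [u v|v]; first exact: connect_support.
by rewrite odd_deg_parity.
Qed.

Lemma edge_join_parity e : edge_join f e -> edge_join g e.
Proof.
move=> j u v /j[c o]; split=> [|w]; first exact: connect_support.
by rewrite odd_deg_parity.
Qed.

End SameParity.

End Joins.

Section MetricClosure.
Variables (R : realType) (n : nat).
Local Open Scope ring_scope.
Implicit Types (e : edge n) (f g : edge n -> nat) (u v w x y z : 'I_n).
Implicit Types (a b : edgevec R n).

(** Reducing multiplicities to at most 2 does not raise a nonnegative cost, so the minimum may be
    sought in a finite set. *)
Lemma min_edge_join a e : (forall e, 0 <= a e) ->
  exists f, edge_join f e /\ forall g, edge_join g e -> cost a f <= cost a g.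
Proof.
move=> a0.
have reduce g : edge_join g e -> exists r : {ffun edge n -> 'I_3},
    `[< edge_join (fun i => r i : nat) e >] /\
    cost a (fun i => r i : nat) <= cost a g.
  move=> jg; have [r rg] := reduce_multiplicities g; exists r; split.
    by apply/asboolP/(@edge_join_parity _ g) => // i; have [] := rg i.
  by apply: ler_cost => // i; have [] := rg i.
have [r0 [jr0 _]] : exists r : {ffun edge n -> 'I_3},
    `[< edge_join (fun i => r i : nat) e >] /\ True.
  have [u [v [uv ev]]] := edge_ends e.
  have [|r [jr _]] := reduce (step u v); last by exists r.
  have -> : e = mkedge uv by apply: val_inj.
  exact: edge_join_mkedge.
pose F (r : {ffun edge n -> 'I_3}) := cost a (fun i => r i : nat).
have [r jr rmin] := @Order.TotalTheory.arg_minP _ R _ r0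
  (fun r : {ffun edge n -> 'I_3} => `[< edge_join (fun i => r i : nat) e >])
  F jr0.
exists (fun i => r i : nat); split; first exact/asboolP.
by move=> g /reduce[r' [/rmin h1 h2]]; apply: le_trans h2.
Qed.

(* [b e] is the least weight of an edge multiset that may replace [e], that is,
   [b] is the shortest path metric of [a]. *)
Lemma metric_closure a : (2 < n)%N -> (forall e, 0 <= a e) ->
  exists b, [/\ metric_cone R n b, forall e, b e <= a e
    & forall f, connected_even f ->
        exists2 g, connected_even g & cost a g = cost b f].
Proof.
move=> n3 a0.
have [G jG] := boolp.choice (fun e => min_edge_join e a0).
exists [ffun e => cost a (G e)]; split.
(* Optimal joins for [uw] and [wv] add up to a join for [uv], so the triangle inequality follows
   from minimality. *)
- move=> u v w uv uw wv; rewrite !ffunE -costD.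
  apply: (jG _).2; apply: (@join_edge _ _ _ u v) => //.
  by apply: (@join_trans _ _ _ _ _ w); apply: (jG _).1.
- move=> e; rewrite ffunE; have [u [v [uv ev]]] := edge_ends e.
  have -> : e = mkedge uv by apply: val_inj.
  by rewrite -cost_mkedge; apply: (jG _).2; apply: edge_join_mkedge.
move=> f cf; exists (fun e => \sum_i f i * G i e)%N.
  by apply: connected_even_subst cf => e; apply: (jG _).1.
rewrite /cost /dot.
under eq_bigr => e _ do rewrite ffunE natr_sum mulr_sumr.
rewrite exchange_big /=; apply: eq_bigr => i _; rewrite !ffunE mulr_suml.
by apply: eq_bigr => e _; rewrite ffunE natrM mulrA mulrAC.
Qed.

End MetricClosure.

(** * Separation from the graphical polyhedron *)

Section GraphicalPolyhedron.
Variables (R : realType) (n : nat).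
Local Open Scope ring_scope.
Local Open Scope classical_set_scope.
Implicit Types (e : edge n) (f g : edge n -> nat) (a b x y z : edgevec R n).

Lemma GTSP_convex (s t : R) x y : 0 <= s -> 0 <= t -> s + t = 1 ->
  GTSP R n x -> GTSP R n y -> GTSP R n (s *: x + t *: y).
Proof. exact: convex_hull_convex. Qed.

Lemma GTSP_charvec f : connected_even f -> GTSP R n (charvec R f).
Proof. by move=> cf; apply: sub_convex_hull; apply: connected_even_generator. Qed.

Lemma connected_even_add_double f k e : connected_even f ->
  connected_even (fun i => f i + (i == e) * k.*2)%N.
Proof.
move=> [conn ev]; split=> [u v|v].
  by apply: connect_adjS (conn u v) => i fi; rewrite addn_gt0 fi.
rewrite degD oddD (negbTE (ev v)) /deg -big_distrl oddM odd_double.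
by rewrite andbF.
Qed.

(** The property passes to convex combinations. At a generator, an even number of copies of [e] may
    be added, and convexity fills in the values between. *)
Lemma GTSP_add_edge e (t : R) y : 0 <= t -> GTSP R n y ->
  GTSP R n (y + t *: charvec R (fun i => i == e : nat)).
Proof.
set d := charvec R _ => t0 Gy; move: y Gy t t0.
suff sub : GTSP R n `<=`
    [set y | forall t : R, 0 <= t -> GTSP R n (y + t *: d)].
  by move=> y /sub.
apply: convex_hull_sub => [s r y1 y2 s0 r0 sr h1 h2 t t0|].
  have -> : s *: y1 + r *: y2 + t *: d =
      s *: (y1 + t *: d) + r *: (y2 + t *: d).
    by rewrite !scalerDr addrACA -scalerDl sr scale1r.
  by apply: GTSP_convex => //; [apply: h1 | apply: h2].
move=> _ [F cF <-] t t0; pose k := Num.bound t.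
have {cF} cF : connected_even F by apply/connected_eulerianE.
have tk : t < k%:R by rewrite archi_boundP.
have k0 : 0 < k%:R :> R by apply: le_lt_trans tk.
(* Since [t < k], the target lies on the segment from [F] to [F] with [2k] extra copies of [e]; [r]
   is the weight of the far end. *)
pose r := t / k.*2%:R.
have k2 : k.*2%:R = 2 * k%:R :> R by rewrite -mul2n natrM.
have r0 : 0 <= r by rewrite divr_ge0.
have r1 : r <= 1 by rewrite /r ler_pdivrMr k2; lra.
have -> : charvec R F + t *: d =
    (1 - r) *: charvec R F + r *: charvec R (fun i => F i + (i == e) * k.*2)%N.
  have tr : t = r * k.*2%:R by rewrite /r divfK // k2 lt0r_neq0 //; lra.
  apply/ffunP => i; rewrite !ffunE natrD natrM tr /GRing.scale /=; ring.
apply: GTSP_convex; rewrite ?subr_ge0 ?subrK //; first exact: GTSP_charvec cF.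
exact: GTSP_charvec (connected_even_add_double _ _ cF).
Qed.

Lemma GTSP_up y x : GTSP R n y -> (forall e, y e <= x e) -> GTSP R n x.
Proof.
move=> Gy yx.
have -> : x = y + \sum_e (x e - y e) *: charvec R (fun i => i == e : nat).
  apply/ffunP => i; rewrite !ffunE sum_ffunE (bigD1 i) //= big1 => [|e ei].
    by rewrite !ffunE eqxx addr0 /GRing.scale /= mulr1 addrC subrK.
  by rewrite !ffunE eq_sym (negbTE ei) scaler0.
elim/big_rec: _ => [|e z _ Gz]; first by rewrite addr0.
by rewrite addrCA addrC; apply: GTSP_add_edge; rewrite ?subr_ge0.
Qed.

(** The extra coordinate [None] is a height: points are put at height 1, directions at height 0. *)
Definition homogenize (x : edgevec R n) (t : R) : {ffun option (edge n) -> R^o} :=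
  [ffun o => if o is Some e then x e else t].

Lemma inner_homogenize (a : {ffun option (edge n) -> R^o}) x t :
  inner a (homogenize x t) = a None * t + dot [ffun e => a (Some e)] x.
Proof.
rewrite /inner (perm_big (None :: map Some (index_enum (edge n)))) /=; last first.
  apply: uniq_perm; rewrite ?index_enum_uniq //=.
    rewrite map_inj_uniq ?index_enum_uniq ?andbT; last by move=> ? ? [].
    by apply/mapP => -[].
  move=> [e|]; rewrite mem_index_enum inE //=; apply/esym/mapP.
  by exists e; rewrite ?mem_index_enum.
rewrite big_cons big_map ffunE; congr (_ + _).
by apply: eq_bigr => e _; rewrite !ffunE.
Qed.

(* Homogenized, the finitely many connected even multigraphs with
   multiplicities at most 2 and the unit vectors generate the cone over the
   polyhedron, so that Farkas' lemma applies. *)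
Lemma GTSP_separation x : GTSP R n !=set0 -> ~ GTSP R n x ->
  exists a (c : R), [/\ forall e, 0 <= a e,
    forall f, connected_even f -> c <= cost a f & dot a x < c].
Proof.
move=> [y0 Gy0] nGx.
pose vs := [seq homogenize (charvec R (fun e => f e : nat)) 1 |
     f : {ffun edge n -> 'I_3} <- enum [pred f : {ffun edge n -> 'I_3} |
         `[< connected_even (fun e => f e : nat) >]]] ++
   [seq homogenize (charvec R (fun i => i == e : nat)) 0 | e <- enum {: edge n}].
have [x_in|[a a_vs ax]] := farkas vs (homogenize x 1).
  (* The cone [K] has the polyhedron as its slice at height 1, by upward closure, and the orthant as
     its slice at height 0. *)
  case: nGx; pose K (z : {ffun option (edge n) -> R^o}) := 0 <= z None /\
    exists2 y, GTSP R n y & forall e, z None * y e <= z (Some e).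
  have [||_ [y Gy yx]] := x_in K.
  - split=> [|s t z1 z2 s0 t0 [z10 [y1 G1 h1]] [z20 [y2 G2 h2]]].
      by split; rewrite ?ffunE //; exists y0 => // e; rewrite !ffunE mul0r.
    have e1 : 0 <= s * z1 None by rewrite mulr_ge0.
    have e2 : 0 <= t * z2 None by rewrite mulr_ge0.
    pose w := s * z1 None + t * z2 None.
    have wE : (s *: z1 + t *: z2) None = w by rewrite !ffunE.
    have w0 : 0 <= w by rewrite addr_ge0.
    rewrite /K wE; split=> //.
    have bound e : s * z1 None * y1 e + t * z2 None * y2 e <=
        (s *: z1 + t *: z2) (Some e).
      by rewrite !ffunE lerD // -mulrA ler_wpM2l.
    have [w_eq0|wn0] := eqVneq w 0.
      exists y0 => // e; rewrite w_eq0 mul0r; apply: le_trans (bound e).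
      have -> : s * z1 None = 0 by rewrite /w in w_eq0; lra.
      have -> : t * z2 None = 0 by rewrite /w in w_eq0; lra.
      by rewrite !mul0r addr0.
    exists ((s * z1 None / w) *: y1 + (t * z2 None / w) *: y2).
      by apply: GTSP_convex; rewrite ?divr_ge0 // -mulrDl divff.
    move=> e; apply: le_trans (bound e); rewrite !ffunE /GRing.scale /=.
    by rewrite le_eqVlt; apply/orP; left; apply/eqP; field.
  - move=> v; rewrite mem_cat => /orP[] /mapP[f + ->].
      rewrite mem_enum => /asboolW cf; split; rewrite ffunE //.
      exists (charvec R (fun e => f e : nat)); first exact: GTSP_charvec cf.
      by move=> e; rewrite !ffunE mul1r.
    move=> _; split; rewrite ffunE //; exists y0 => // e.
    by rewrite !ffunE mul0r.
  by apply: GTSP_up Gy _ => e; have := yx e; rewrite !ffunE mul1r.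
pose a' : edgevec R n := [ffun e => a (Some e)].
have a'0 e : 0 <= a' e.
  have : homogenize (charvec R (fun i => i == e : nat)) 0 \in vs.
    by rewrite mem_cat; apply/orP; right; apply: map_f; rewrite mem_enum.
  move/a_vs; rewrite inner_homogenize mulr0 add0r.
  rewrite /dot (bigD1 e) //= big1 => [|i /negbTE ie].
    by rewrite [charvec _ _ _]ffunE eqxx mulr1 addr0.
  by rewrite [charvec _ _ _]ffunE ie mulr0.
(* Nonnegativity on a generator at height 1 says that its cost is at least [- a None]; other
   multigraphs are first reduced to multiplicities at most 2. *)
exists a', (- a None); split=> // [f cf|].
  have [r rf] := reduce_multiplicities f.
  apply: (@le_trans _ _ (cost a' (fun e => r e : nat))); last first.
    by apply: ler_cost => // e; have [] := rf e.
  have : homogenize (charvec R (fun e => r e : nat)) 1 \in vs.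
    rewrite mem_cat; apply/orP; left; apply: map_f; rewrite mem_enum.
    by apply/asboolP/(@connected_even_parity _ f) => // e; have [] := rf e.
  by move/a_vs; rewrite inner_homogenize mulr1 -/a' -/(cost _ _); lra.
by move: ax; rewrite inner_homogenize mulr1 -/a'; lra.
Qed.

End GraphicalPolyhedron.

(** * The two inclusions *)

Local Open Scope classical_set_scope.

Theorem mainTheorem1 (R : realType) (n : nat) (hn : (3 <= n)%N) :
  GTSP R n =
  minkowski_sum (STSP R n) (polar (metric_cone R n)) `&` orthant R n.
Proof.
apply/seteqP; split=> [|x [[s Ss [c Cc <-]] x0]].
  (* The right-hand side is convex, so only generators need shortcutting. *)
  apply: convex_hull_sub => [s t x y s0 t0 st|].
    move=> [[x1 Sx1 [x2 Cx2 <-]] Ox] [[y1 Sy1 [y2 Cy2 <-]] Oy]; split.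
      exists (s *: x1 + t *: y1)%R; first exact: convex_hull_convex.
      exists (s *: x2 + t *: y2)%R => [a ma|].
        by rewrite dotDr !dotZr addr_ge0 ?mulr_ge0 ?Cx2 ?Cy2.
      by rewrite !scalerDr addrACA.
    move=> e; rewrite ffunE; apply: addr_ge0; rewrite ffunE.
      by apply: mulr_ge0 => //; exact: Ox.
    by apply: mulr_ge0 => //; exact: Oy.
  move=> _ [F /connected_eulerianE cF <-].
  have [C hC leC] := hamiltonian_shortcut R hn cF.
  split; last by move=> e; rewrite ffunE ler0n.
  exists (charvec R (fun e => e \in C : nat)).
    by apply: sub_convex_hull; exists C.
  exists (charvec R F - charvec R (fun e => e \in C : nat))%R; last exact: subrKC.
  by move=> a ma; rewrite dotDr dotNr subr_ge0 leC.
apply: contrapT => nG.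
have STSP_GTSP : STSP R n `<=` GTSP R n.
  apply: convex_hull_sub => [|_ [C hC <-]]; first exact: GTSP_convex.
  exact: GTSP_charvec (hamiltonian_connected_even hn hC).
have [a [beta [a0 a_beta]]] := GTSP_separation (ex_intro _ s (STSP_GTSP s Ss)) nG.
have [b [mb ba bf]] := metric_closure hn a0.
(* A half-space is convex, so Hamiltonian cycles suffice; the [b]-cost of each is the [a]-cost of a
   connected Eulerian multigraph. *)
have b_beta : STSP R n `<=` [set z | (beta <= dot b z)%R].
  apply: convex_hull_sub => [u v y z u0 v0 uv hy hz|_ [C hC <-]] /=.
    rewrite dotDr !dotZr -[beta]mul1r -uv mulrDl.
    by apply: lerD; apply: ler_wpM2l.
  have [g cg gE] := bf _ (hamiltonian_connected_even hn hC).
  by rewrite -[dot b _]/(cost b _) -gE; exact: a_beta.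
(* Passing from [a] down to [b] uses that [x] lies in the orthant. *)
apply/negP; rewrite -leNgt; apply: le_trans (ler_dotl x0 ba).
by rewrite dotDr -[beta]addr0; apply: lerD; [exact: b_beta | exact: Cc].
Qed.
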